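(* Let $A = \begin{pmatrix} 1 & 2 \\ -1 & 5 \end{pmatrix}$. Then $A$ is an anti-sign symmetric $2\times 2$ real matrix such that for every positive diagonal matrix $D = \mathrm{diag}\{d_{11}, d_{22}\}$ (with $d_{11}, d_{22} > 0$) the matrix $(DA)^2$ is a $Q$-matrix, but $A^2$ is not a $P_0$-matrix (and hence not a $P_0^+$-matrix). Consequently, the implication ''if $(DA)^2$ is a $Q$-matrix for every positive diagonal matrix $D$, then $A^2$ is a $P_0^+$-matrix'' is false for square matrices $A$ in general; it is false already within the class of $2\times 2$ matrices, and it is false within the class of anti-sign symmetric matrices.
   Context: All matrices are real. For an $n\times n$ matrix $A$ and index sets $\alpha,\beta\subset\{1,\ldots,n\}$ with $|\alpha|=|\beta|$, $A\begin{pmatrix}\alpha\\ \beta\end{pmatrix}$ denotes the minor of $A$ with rows indexed by $\alpha$ and columns indexed by $\beta$ (indices in increasing order); it is a principal minor when $\alpha=\beta$, and its order is $|\alpha|$. An $n\times n$ matrix is a $Q$-matrix if, for every $j=1,\ldots,n$, the sum of all its principal minors of order $j$ is positive. An $n\times n$ matrix is a $P_0$-matrix if all its principal minors are nonnegative. It is a $P_0^+$-matrix if all its principal minors are nonnegative and, for each order $j=1,\ldots,n$, at least one principal minor of order $j$ is positive. An $n\times n$ matrix $A$ is anti-sign symmetric if $A\begin{pmatrix}\alpha\\ \beta\end{pmatrix}A\begin{pmatrix}\beta\\ \alpha\end{pmatrix}\le 0$ for all $\alpha,\beta\subset\{1,\ldots,n\}$ with $\alpha\neq\beta$ and $|\alpha|=|\beta|$.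 A positive diagonal matrix is a diagonal matrix with all diagonal entries positive. *)

(* Defs.v *)
From HB Require Import structures.
From mathcomp Require Import all_boot all_order all_algebra.
From mathcomp Require Import reals.

Set Implicit Arguments.
Unset Strict Implicit.
Unset Printing Implicit Defensive.

Import Order.TTheory GRing.Theory Num.Theory.
Local Open Scope ring_scope.

(* [enum_val] lists a subset of 'I_n in increasing order, as required for the
   sign of non-principal minors. *)
Definition minor (R : realDomainType) (n : nat) (A : 'M[R]_n)
    (alpha beta : {set 'I_n}) (eq_card : #|alpha| = #|beta|) : R :=
  \det (mxsub (fun i : 'I_#|alpha| => enum_val i)
              (fun j : 'I_#|alpha| => enum_val (cast_ord eq_card j)) A).

Definition principal_minor (R : realDomainType) (n : nat) (A : 'M[R]_n)
    (alpha : {set 'I_n}) : R :=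
  minor A (erefl #|alpha|).

Definition Q_matrix (R : realDomainType) (n : nat) (A : 'M[R]_n) : Prop :=
  forall j : nat, (1 <= j <= n)%N ->
    0 < \sum_(alpha : {set 'I_n} | #|alpha| == j) principal_minor A alpha.

(* Allowing alpha to be empty is harmless: the empty minor is 1. *)
Definition P0_matrix (R : realDomainType) (n : nat) (A : 'M[R]_n) : Prop :=
  forall alpha : {set 'I_n}, 0 <= principal_minor A alpha.

Definition P0plus_matrix (R : realDomainType) (n : nat) (A : 'M[R]_n) : Prop :=
  P0_matrix A /\
  forall j : nat, (1 <= j <= n)%N ->
    exists alpha : {set 'I_n}, #|alpha| = j /\ 0 < principal_minor A alpha.

Definition anti_sign_symmetric (R : realDomainType) (n : nat)
    (A : 'M[R]_n) : Prop :=
  forall (alpha beta : {set 'I_n}) (eq_card : #|alpha| = #|beta|),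
    alpha <> beta -> minor A eq_card * minor A (esym eq_card) <= 0.

Definition positive_diagonal (R : realDomainType) (n : nat)
    (D : 'M[R]_n) : Prop :=
  is_diag_mx D /\ forall i : 'I_n, 0 < D i i.

Definition counterexample_mx (R : realDomainType) : 'M[R]_2 :=
  \matrix_(i < 2, j < 2)
    nth 0 (nth [::] [:: [:: 1;  2];
                        [:: -1; 5]] i) j.

(* Main.v *)
Require Import Defs.
From HB Require Import structures.
From mathcomp Require Import all_boot all_order all_algebra.
From mathcomp Require Import perm reals ring lra.

Set Implicit Arguments.
Unset Strict Implicit.
Unset Printing Implicit Defensive.

Import Order.TTheory GRing.Theory Num.Theory.
Local Open Scope ring_scope.

(** For a 2 x 2 matrix the Q-matrix property only asks that the trace and the
    determinant be positive ([Q_matrix2]).  With [D = diag(a, b)] and [A] the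
    given matrix,
<<
      tr ((DA)^2)  = a^2 - 4ab + 25b^2 = (a - 2b)^2 + 21b^2,
      det ((DA)^2) = (det D * det A)^2 = (7ab)^2,
>>
    and both are positive as soon as [a, b > 0].  On the other hand the upper
    left entry of [A^2] is [1 * 1 + 2 * (-1) = -1], a negative principal minor
    of order 1.  Distinct index sets of equal size in a two-element set are
    singletons, so anti-sign symmetry reduces to the sign of the single product
    [2 * (-1)] of the off-diagonal entries. *)

(** The matrix size is a variable, with its value as a hypothesis, because the
    size [#|[set i]|] of a minor is only propositionally equal to 1. *)
Lemma det_size1 (R : comPzRingType) (m : nat) (M : 'M[R]_m) (k : 'I_m) :
  m = 1%N -> \det M = M k k.
Proof. by move=> m1; subst m; rewrite det_mx11 (ord1 k). Qed.

Lemma det_mx2 (R : comPzRingType) (M : 'M[R]_2) :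
  \det M = M 0 0 * M 1 1 - M 1 0 * M 0 1.
Proof.
rewrite (expand_det_col _ 0) !(big_ord_recl, big_ord0) /cofactor !det_mx11 !mxE.
have lift00 : lift ord0 ord0 = 1 :> 'I_2 by exact: val_inj.
have lift10 : lift 1 0 = 0 :> 'I_2 by exact: val_inj.
by rewrite /= lift00 lift10 addr0 expr0 expr1 mul1r mulN1r mulrN.
Qed.

Lemma minor_set1 (R : realDomainType) (n : nat) (A : 'M[R]_n) (i j : 'I_n)
    (eq_card : #|[set i]| = #|[set j]|) :
  minor A eq_card = A i j.
Proof.
have k : 'I_#|[set i]| by rewrite cards1; exact: ord0.
rewrite /minor (det_size1 _ k) ?cards1 // mxE.
by congr (A _ _); apply/set1P; exact: enum_valP.
Qed.

(** An injective reindexing of a set of the same size is a permutation, and its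
    sign occurs twice, once for the rows and once for the columns. *)
Lemma det_mxsub_inj (R : comPzRingType) (m n : nat) (f : 'I_m -> 'I_n)
    (A : 'M[R]_n) :
  m = n -> injective f -> \det (mxsub f f A) = \det A.
Proof.
move=> mn; subst m => f_inj.
have -> : mxsub f f A = row_perm (perm f_inj) (col_perm (perm f_inj) A).
  by apply/matrixP=> i j; rewrite !mxE !permE.
rewrite row_permE col_permE !det_mulmx !det_perm mulrCA mulrA.
by rewrite odd_permV -mulrA -expr2 sqrr_sign mulr1.
Qed.

Lemma principal_minor_setT (R : realDomainType) (n : nat) (A : 'M[R]_n) :
  principal_minor A setT = \det A.
Proof.
rewrite /principal_minor /minor -(@det_mxsub_inj _ _ _ (@enum_val _ setT) A).
- by congr (\det _); apply/matrixP=> i j; rewrite !mxE cast_ord_id.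
- by rewrite cardsT card_ord.
- exact: enum_val_inj.
Qed.

Lemma sum_principal_minor1 (R : realDomainType) (n : nat) (A : 'M[R]_n) :
  \sum_(alpha : {set 'I_n} | #|alpha| == 1%N) principal_minor A alpha = \tr A.
Proof.
rewrite (eq_bigl [in set1 @: [set: 'I_n]]) => [|alpha]; last first.
  apply/cards1P/imsetP => [[i ->]|[i _ ->]]; by exists i.
rewrite big_imset /=; last by move=> i j _ _; exact: set1_inj.
rewrite /mxtrace; apply: eq_big => [i|i _]; first by rewrite inE.
exact: minor_set1.
Qed.

Lemma sum_principal_minor_full (R : realDomainType) (n : nat) (A : 'M[R]_n) :
  \sum_(alpha : {set 'I_n} | #|alpha| == n) principal_minor A alpha = \det A.
Proof.
rewrite (big_pred1 setT) ?principal_minor_setT // => alpha /=.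
have le_n : (#|alpha| <= n)%N by rewrite -[leqRHS]card_ord max_card.
by rewrite eqEcard subsetT cardsT card_ord eqn_leq le_n.
Qed.

Lemma Q_matrix2 (R : realDomainType) (A : 'M[R]_2) :
  0 < \tr A -> 0 < \det A -> Q_matrix A.
Proof.
move=> tr_gt0 det_gt0 [|[|[|j]]] // _.
- by rewrite sum_principal_minor1.
- by rewrite sum_principal_minor_full.
Qed.

Lemma anti_sign_symmetric2 (R : realDomainType) (A : 'M[R]_2) :
  A 0 1 * A 1 0 <= 0 -> anti_sign_symmetric A.
Proof.
move=> A_le0 alpha beta eq_card neq.
have le2 : (#|alpha| <= 2)%N by rewrite -[leqRHS](card_ord 2) max_card.
have card1 : #|alpha| = 1%N.
  case Ealpha: #|alpha| le2 => [|[|[|k]]] // _; case: neq.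
    by rewrite (cards0_eq Ealpha) (@cards0_eq _ beta) // -eq_card.
  have full (B : {set 'I_2}) : #|B| = 2 -> B = setT.
    by move=> B2; apply/eqP; rewrite eqEcard subsetT cardsT card_ord B2.
  by rewrite (full _ Ealpha) (full beta) // -eq_card.
have /cards1P[j defb] : #|beta| == 1%N by rewrite -eq_card card1.
have /cards1P[i defa] : #|alpha| == 1%N by rewrite card1.
subst alpha beta; rewrite !minor_set1.
have neq_ij : i <> j by move=> ij; apply: neq; rewrite ij.
have ord2 (k : 'I_2) : k = 0 \/ k = 1.
  by case: k => [[|[|k]] ltk] //; [left|right]; exact: val_inj.
case: (ord2 i) (ord2 j) neq_ij => [-> | ->] [-> | ->] // _.
by rewrite mulrC.
Qed.

Lemma counterexample_anti_sign_symmetric (R : realType) :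
  anti_sign_symmetric (counterexample_mx R).
Proof. by apply: anti_sign_symmetric2; rewrite !mxE /=; lra. Qed.

Lemma counterexample_scaled_sqr_Q (R : realType) (D : 'M[R]_2) :
  positive_diagonal D -> Q_matrix ((D *m counterexample_mx R) ^+ 2).
Proof.
case=> /is_diag_mxP D_diag D_gt0.
have D01 : D 0 1 = 0 by exact: D_diag.
have D10 : D 1 0 = 0 by exact: D_diag.
have a_gt0 := D_gt0 0; have b_gt0 := D_gt0 1.
have ord1E : lift ord0 ord0 = 1 :> 'I_2 by exact: val_inj.
rewrite expr2; apply: Q_matrix2.
- rewrite /mxtrace !(big_ord_recl, big_ord0, mxE) /= ord1E D01 D10.
  set a := D 0 0 in a_gt0 *; set b := D 1 1 in b_gt0 *.
  have b2_gt0 : 0 < b ^+ 2 by rewrite exprn_gt0.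
  have sq_ge0 : 0 <= (a - 2 * b) ^+ 2 by exact: sqr_ge0.
  rewrite [ltRHS](_ : _ = (a - 2 * b) ^+ 2 + 21 * b ^+ 2); last by ring.
  lra.
- rewrite det_mulmx -expr2 exprn_even_gt0 //= det_mulmx !det_mx2 D01 D10 !mxE /=.
  by rewrite mul0r subr0 !mulf_neq0 ?gt_eqF //; lra.
Qed.

Lemma counterexample_sqr_not_P0 (R : realType) :
  ~ P0_matrix (counterexample_mx R ^+ 2).
Proof.
move=> /(_ [set 0]); rewrite /principal_minor minor_set1 expr2.
by rewrite !(big_ord_recl, big_ord0, mxE) /=; lra.
Qed.

Theorem mainTheorem1 (R : realType) :
  (let A := counterexample_mx R in
   [/\ anti_sign_symmetric A,
       (forall D : 'M[R]_2, positive_diagonal D ->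
          Q_matrix ((D *m A) ^+ 2)),
       ~ P0_matrix (A ^+ 2) &
       ~ P0plus_matrix (A ^+ 2)]) /\
  (~ (forall (n : nat) (A : 'M[R]_n), (0 < n)%N ->
        (forall D : 'M[R]_n, positive_diagonal D ->
           Q_matrix ((D *m A) ^+ 2)) ->
        P0plus_matrix (A ^+ 2))) /\
  (~ (forall A : 'M[R]_2,
        (forall D : 'M[R]_2, positive_diagonal D ->
           Q_matrix ((D *m A) ^+ 2)) ->
        P0plus_matrix (A ^+ 2))) /\
  (~ (forall (n : nat) (A : 'M[R]_n), (0 < n)%N ->
        anti_sign_symmetric A ->
        (forall D : 'M[R]_n, positive_diagonal D ->
           Q_matrix ((D *m A) ^+ 2)) ->
        P0plus_matrix (A ^+ 2))).
Proof.
have asym := @counterexample_anti_sign_symmetric R.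
have scaledQ := @counterexample_scaled_sqr_Q R.
have notP0 := @counterexample_sqr_not_P0 R.
split; first by split => // -[].
split; first by move=> /(_ 2 _ isT scaledQ) [].
split; first by move=> /(_ _ scaledQ) [].
by move=> /(_ 2 _ isT asym scaledQ) [].
Qed.
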